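(* Among the $2$-dimensional complex multiplicative Hom-Lie superalgebras in the list 1. $\mathfrak{g}^1_{0;2}$: abelian, of superdimension $(0|2)$; 2. $\mathfrak{g}^2_{1;1}$: abelian, of superdimension $(1|1)$; 3. $\mathfrak{g}^{3,b}_{1;1}$ ($b\in\mathbb{C}$): $[e_0,e_1]=e_1$, $[e_1,e_1]=0$, $\alpha(e_0)=e_0$, $\alpha(e_1)=be_1$; 4. $\mathfrak{g}^{4,a}_{1;1}$ ($a\in\mathbb{C}$, $a\ne0,1$): $[e_0,e_1]=e_1$, $[e_1,e_1]=0$, $\alpha(e_0)=ae_0$, $\alpha(e_1)=0$; 5. $\mathfrak{g}^{5,b}_{1;1}$ ($b\in\mathbb{C}$, $b\neq0$): $[e_0,e_1]=0$, $[e_1,e_1]=e_0$, $\alpha(e_0)=b^2e_0$, $\alpha(e_1)=be_1$, the complete ones are precisely $\mathfrak{g}^{3,b}_{1;1}$ with $b\in\mathbb{C}^{*}=\mathbb{C}\setminus\{0\}$.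
   Context: All spaces are over $\mathbb{C}$. A multiplicative Hom-Lie superalgebra $(\mathfrak{g},[\cdot,\cdot],\alpha)$ is a $\mathbb{Z}_2$-graded space $\mathfrak{g}=\mathfrak{g}_{\bar0}\oplus\mathfrak{g}_{\bar1}$ with an even bilinear bracket ($[\mathfrak{g}_{\bar i},\mathfrak{g}_{\bar j}]\subseteq\mathfrak{g}_{\bar i+\bar j}$) and an even (grading-preserving) linear map $\alpha$ such that $\alpha([x,y])=[\alpha(x),\alpha(y)]$ and, for homogeneous $x,y,z$: $[x,y]=-(-1)^{|x||y|}[y,x]$ and $\sum_{\circlearrowleft_{x,y,z}}(-1)^{|x||z|}[\alpha(x),[y,z]]=0$ (cyclic sum). Superdimension $(i|j)$ means $\dim\mathfrak{g}_{\bar0}=i$, $\dim\mathfrak{g}_{\bar1}=j$; abelian means zero bracket. In superdimension $(1|1)$, $e_0$ spans $\mathfrak{g}_{\bar0}$ and $e_1$ spans $\mathfrak{g}_{\bar1}$; unlisted products follow from super-skew-symmetry. (This list is the known classification of $2$-dimensional complex multiplicative Hom-Lie superalgebras by Wang, Zhang and Wei.) The center is $C(\mathfrak{g})=\{x:[x,\mathfrak{g}]=0\}$. With $\alpha^0=\mathrm{id}$, an $\alpha^k$-derivation is a homogeneous linear map $D$ of parity $|D|$ with $D\alpha=\alpha D$ and $D([x,y])=[D(x),\alpha^k(y)]+(-1)^{|D||x|}[\alpha^k(x),D(y)]$ for homogeneous $x,y$; $\operatorname{Der}_{\alpha^k}(\mathfrak{g})$ is the direct sum of the spaces of even and odd ones.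 For homogeneous $x$ with $\alpha(x)=x$, put $\operatorname{ad}_x^k(y)=[x,\alpha^k(y)]$; $\operatorname{Inn}_{\alpha^k}(\mathfrak{g})\subseteq\operatorname{Der}_{\alpha^{k+1}}(\mathfrak{g})$ is the span of these maps. $\mathfrak{g}$ is complete if $C(\mathfrak{g})=\{0\}$ and $\operatorname{Der}_{\alpha^{k+1}}(\mathfrak{g})=\operatorname{Inn}_{\alpha^k}(\mathfrak{g})$ for every integer $k\ge0$. *)

(* Defs.v *)
From HB Require Import structures.
From mathcomp Require Import all_boot all_order all_algebra.
From mathcomp Require Import complex.
From mathcomp Require Import reals.

Set Implicit Arguments.
Unset Strict Implicit.
Unset Printing Implicit Defensive.

Import GRing.Theory.
Local Open Scope ring_scope.

(* Parities are booleans: [false] is even, [true] is odd, [addb] is addition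
   in Z/2 and [andb] the product of parities in sign exponents.
   A bilinear bracket is given by its curried form x |-> [x, -]. *)
Record homLieSuperalgebra (K : fieldType) := HomLieSuperalgebra {
  carrier :> vectType K;
  part : bool -> {vspace carrier};
  br : 'Hom(carrier, 'End(carrier));
  twist : 'End(carrier);
  part_sum : (part false + part true)%VS = fullv;
  part_cap : (part false :&: part true)%VS = 0%VS;
  br_even : forall (i j : bool) (x y : carrier),
    x \in part i -> y \in part j -> br x y \in part (i (+) j);
  twist_even : forall (i : bool) (x : carrier),
    x \in part i -> twist x \in part i;
  twist_mult : forall x y : carrier, twist (br x y) = br (twist x) (twist y);
  br_skew : forall (i j : bool) (x y : carrier),
    x \in part i -> y \in part j ->
    br x y = - ((-1) ^+ (i && j) *: br y x);
  br_jacobi : forall (i j l : bool) (x y z : carrier),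
    x \in part i -> y \in part j -> z \in part l ->
    (-1) ^+ (i && l) *: br (twist x) (br y z)
    + (-1) ^+ (j && i) *: br (twist y) (br z x)
    + (-1) ^+ (l && j) *: br (twist z) (br x y) = 0
}.

Section HomLieSuperalgebraTheory.

Variables (K : fieldType) (g : homLieSuperalgebra K).
Implicit Types (i j d : bool) (k : nat) (x y : g) (D : 'End(g)).

Definition superdim (m n : nat) : Prop :=
  \dim (part g false) = m /\ \dim (part g true) = n.

Definition abelian_hls : Prop := forall x y, br g x y = 0.

Definition in_center x : Prop := forall y, br g x y = 0.

Definition twist_pow k : 'End(g) := iter k (comp_lfun (twist g)) \1%VF.

Definition homogeneous_der k d D : Prop :=
  [/\ forall i x, x \in part g i -> D x \in part g (d (+) i),
      forall x, D (twist g x) = twist g (D x)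
    & forall i j x y, x \in part g i -> y \in part g j ->
        D (br g x y) = br g (D x) (twist_pow k y)
                       + (-1) ^+ (d && i) *: br g (twist_pow k x) (D y)].

Definition der k D : Prop :=
  exists D0 D1 : 'End(g),
    [/\ homogeneous_der k false D0, homogeneous_der k true D1 & D = D0 + D1].

Definition ad k x : 'End(g) := (br g x \o twist_pow k)%VF.

Definition inner_der k D : Prop :=
  exists (n : nat) (c : 'I_n -> K) (x : 'I_n -> g),
    (forall s, (exists i, x s \in part g i) /\ twist g (x s) = x s)
    /\ D = \sum_(s < n) c s *: ad k (x s).

Definition complete_hls : Prop :=
  (forall x, in_center x <-> x = 0)
  /\ (forall k D, der k.+1 D <-> inner_der k D).

(* [e0] and [e1] are a basis of the even and of the odd part; the brackets that
   do not appear in the tables below follow by super-skew-symmetry. *)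
Definition basis11 (e0 e1 : g) : Prop :=
  [/\ superdim 1 1, part g false = <[e0]>%VS & part g true = <[e1]>%VS].

Definition is_g1_02 : Prop := superdim 0 2 /\ abelian_hls.

Definition is_g2_11 : Prop := superdim 1 1 /\ abelian_hls.

Definition is_g3_11 (b : K) : Prop :=
  exists e0 e1 : g, basis11 e0 e1 /\
    [/\ br g e0 e1 = e1, br g e1 e1 = 0,
        twist g e0 = e0 & twist g e1 = b *: e1].

Definition is_g4_11 (a : K) : Prop :=
  exists e0 e1 : g, basis11 e0 e1 /\
    [/\ br g e0 e1 = e1, br g e1 e1 = 0,
        twist g e0 = a *: e0 & twist g e1 = 0].

Definition is_g5_11 (b : K) : Prop :=
  exists e0 e1 : g, basis11 e0 e1 /\
    [/\ br g e0 e1 = 0, br g e1 e1 = e0,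
        twist g e0 = b ^+ 2 *: e0 & twist g e1 = b *: e1].

End HomLieSuperalgebraTheory.

(* Main.v *)
Require Import Defs.
From HB Require Import structures.
From mathcomp Require Import all_boot all_order all_algebra.
From mathcomp Require Import complex.
From mathcomp Require Import reals.

Local Open Scope ring_scope.
Import GRing.Theory Num.Theory.

(** In every non-complete case one of the two defining conditions fails for a
    visible reason. The abelian algebras and those with [e1, e1] = e0 have a
    nonzero center: in the latter, e0 brackets to zero with e1, and also with
    itself because the bracket alternates on even elements. When instead
    [e0, e1] = e1 and alpha kills e1 ([is_g4_11], and [is_g3_11] at
    b = 0), the center is zero but alpha-derivations are too abundant: the
    projection onto the even part is one ([even_proj_der]), since in its Leibniz
    rule on [e0, e1] the only term that could be nonzero is [e0, alpha e1] = 0.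
    No inner derivation equals it, because the only fixed homogeneous elements
    are multiples of e0, so that every inner derivation kills e0
    ([twist_e1_not_complete]).

    When b is nonzero the same Leibniz rule, applied to e1 = [e0, e1], is rigid:
    for an even D with D e0 = p e0 it forces p b^(k+1) = 0, so D only rescales
    e1, exactly as a multiple of ad e0 does; for an odd D with D e1 = s e0 it
    forces s = 0, and D alpha = alpha D makes D e0 a fixed point r e1, so that
    D is the inner derivation attached to the fixed element - r e1
    ([g3_complete]). The converse inclusion is general: by the Jacobi identity,
    bracketing with a fixed homogeneous element after alpha^k is an
    alpha^(k+1)-derivation ([ad_homogeneous_der]). *)

Set Implicit Arguments.
Unset Strict Implicit.
Unset Printing Implicit Defensive.

(** * Inner derivations in arbitrary dimension *)

Section AnyDimension.

Variables (K : fieldType) (g : homLieSuperalgebra K).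
Implicit Types (i j d : bool) (k : nat) (x y z : g) (D : 'End(g)).

Lemma twist_pow0 x : twist_pow g 0 x = x.
Proof. by rewrite /twist_pow id_lfunE. Qed.

Lemma twist_powS k x : twist_pow g k.+1 x = twist g (twist_pow g k x).
Proof. by rewrite /twist_pow /= comp_lfunE. Qed.

Lemma twist_pow_even k i x : x \in part g i -> twist_pow g k x \in part g i.
Proof.
by move=> xi; elim: k => [|k IHk]; rewrite ?twist_pow0 // twist_powS twist_even.
Qed.

Lemma twist_pow_twist k x :
  twist_pow g k (twist g x) = twist g (twist_pow g k x).
Proof. by elim: k => [|k IHk]; rewrite ?twist_pow0 // !twist_powS IHk. Qed.

Lemma twist_pow_mult k x y :
  twist_pow g k (br g x y) = br g (twist_pow g k x) (twist_pow g k y).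
Proof.
by elim: k => [|k IHk]; rewrite ?twist_pow0 // !twist_powS IHk twist_mult.
Qed.

Lemma twist_pow_eigen k (a : K) x :
  twist g x = a *: x -> twist_pow g k x = a ^+ k *: x.
Proof.
move=> ax; elim: k => [|k IHk]; first by rewrite twist_pow0 scale1r.
by rewrite twist_powS IHk linearZ /= ax scalerA -exprSr.
Qed.

Lemma adE k x y : ad k x y = br g x (twist_pow g k y).
Proof. by rewrite /ad comp_lfunE. Qed.

Lemma ad_is_linear k : linear (@ad K g k).
Proof.
move=> a x y; apply/lfunP=> z.
by rewrite add_lfunE scale_lfunE !adE linearP add_lfunE scale_lfunE.
Qed.

HB.instance Definition _ k :=
  GRing.isLinear.Build K g 'End(g) *:%R (@ad K g k) (ad_is_linear k).

Lemma br_scalel (a : K) x y : br g (a *: x) y = a *: br g x y.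
Proof. by rewrite linearZ scale_lfunE. Qed.

Lemma br_scale (a b : K) x y : br g (a *: x) (b *: y) = (a * b) *: br g x y.
Proof. by rewrite !linearZ /= scale_lfunE scalerA mulrC. Qed.

(** This is the Jacobi identity solved for its first term: super-skew-symmetry
    turns the other two into the terms of a twisted Leibniz rule, and the common
    sign (-1)^(|x||z|) cancels. *)
Lemma br_leibniz d i j x y z :
    x \in part g d -> y \in part g i -> z \in part g j ->
  br g (twist g x) (br g y z) =
    br g (br g x y) (twist g z)
    + (-1) ^+ (d && i) *: br g (twist g y) (br g x z).
Proof.
move=> xd yi zj; apply/eqP; rewrite -subr_eq0; apply/eqP.
have := br_jacobi xd yi zj.
rewrite (br_skew zj xd) linearN linearZ /=.
rewrite (br_skew (twist_even zj) (br_even xd yi)).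
move/(congr1 (fun u => (-1) ^+ (d && j) *: u)); rewrite scaler0 => <-.
(* After skew-symmetry both sides are the same three brackets, with signs that
   depend on the parities only. *)
case: d i j {xd yi zj} => [] [] [];
  rewrite /= ?expr0 ?expr1 ?(scale1r, scaleN1r, scalerN, opprK, opprD);
  by rewrite ?addrA ?opprK // addrAC.
Qed.

(** The exponent goes up by one because the Jacobi identity is twisted: applying
    it to x = alpha x, alpha^k y and alpha^k z leaves an extra alpha on the
    arguments not bracketed with x. *)
Lemma ad_homogeneous_der k d x :
  x \in part g d -> twist g x = x -> homogeneous_der k.+1 d (ad k x).
Proof.
move=> xd fx; split=> [i y yi | y | i j y z yi zj].
- by rewrite adE br_even ?twist_pow_even.
- by rewrite !adE twist_pow_twist twist_mult fx.
- rewrite !adE twist_pow_mult !twist_powS -{1}fx.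
  by rewrite (br_leibniz xd (twist_pow_even k yi) (twist_pow_even k zj)).
Qed.

(** The fixed elements of a given parity form a subspace and ad is linear, so an
    arbitrary span of inner derivations collapses to one even and one odd
    generator. *)
Lemma inner_derP k D :
  inner_der k D <->
  exists y0 y1, [/\ y0 \in part g false, y1 \in part g true,
    twist g y0 = y0, twist g y1 = y1 & D = ad k y0 + ad k y1].
Proof.
split=> [[n [c [x [hx ->]]]] | [y0 [y1 [y0P y1P f0 f1 ->]]]].
  elim/big_ind: _ =>
    [|E E' [x0 [x1 [x0P x1P f0 f1 ->]]] [z0 [z1 [z0P z1P h0 h1 ->]]]|s _].
  - by exists 0, 0; rewrite !mem0v !linear0 addr0.
  - exists (x0 + z0), (x1 + z1); rewrite !rpredD // !linearD /= f0 f1 h0 h1.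
    by split=> //; rewrite addrACA.
  have [[i xi] fx] := hx s.
  case: i xi => xi.
  - exists 0, (c s *: x s).
    by rewrite mem0v !linear0 add0r !linearZ /= fx rpredZ.
  - exists (c s *: x s), 0.
    by rewrite mem0v !linear0 addr0 !linearZ /= fx rpredZ.
exists 2, (fun=> 1), (fun s : 'I_2 => if val s is 0%N then y0 else y1); split.
  by case=> [[|s] ?] /=; split=> //; [exists false | exists true].
by rewrite big_ord_recl big_ord1 /= !scale1r.
Qed.

Lemma inner_der_der k D : inner_der k D -> der k.+1 D.
Proof.
case/inner_derP=> y0 [y1 [y0P y1P f0 f1 ->]].
by exists (ad k y0), (ad k y1); split=> //; apply: ad_homogeneous_der.
Qed.

Lemma br_even_diag x : (2 : K) != 0 -> x \in part g false -> br g x x = 0.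
Proof.
move=> two xP; have := br_skew xP xP; rewrite expr0 scale1r => /eqP.
rewrite -addr_eq0 -mulr2n -scaler_nat scaler_eq0 (negPf two) /=.
by move/eqP.
Qed.

Lemma central_not_complete x : x != 0 -> in_center x -> ~ complete_hls g.
Proof. by move=> /eqP nx cx [hc _]; apply: nx; apply/hc. Qed.

Lemma dim_sum m n : superdim g m n -> \dim {:g} = (m + n)%N.
Proof.
case=> <- <-; rewrite -(part_sum g) dimv_disjoint_sum //; exact: part_cap.
Qed.

Lemma abelian_not_complete m n :
  (0 < m + n)%N -> superdim g m n -> abelian_hls g -> ~ complete_hls g.
Proof.
move=> mn sd ab.
have nx : vpick {:g} != 0 by rewrite vpick0 -dimv_eq0 (dim_sum sd) -lt0n.
exact: central_not_complete nx (ab _).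
Qed.

Definition even_proj : 'End(g) := daddv_pi (part g false) (part g true).

Lemma even_projE0 x : x \in part g false -> even_proj x = x.
Proof. exact/daddv_pi_id/part_cap. Qed.

Lemma even_projE1 x : x \in part g true -> even_proj x = 0.
Proof.
move=> xP; apply: (addrI (daddv_pi (part g true) (part g false) x)).
rewrite addr0 addrC daddv_pi_add ?part_cap ?part_sum ?memvf //.
by rewrite daddv_pi_id // capvC part_cap.
Qed.

End AnyDimension.

(** * Superdimension (1|1) *)

Section Superdimension11.

Variables (K : fieldType) (g : homLieSuperalgebra K) (e0 e1 : g).
Hypotheses (two : (2 : K) != 0) (basis : basis11 e0 e1).
Implicit Types (a b : K) (k : nat) (x y : g) (D : 'End(g)).

Lemma e0_neq0 : e0 != 0.
Proof.
by case: basis => -[d0 _] p0 _; move: d0; rewrite p0 dim_vline; case: eqP.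
Qed.

Lemma e1_neq0 : e1 != 0.
Proof.
by case: basis => -[_ d1] _ p1; move: d1; rewrite p1 dim_vline; case: eqP.
Qed.

Lemma part0P x : reflect (exists c, x = c *: e0) (x \in part g false).
Proof. by case: basis => _ -> _; apply: vlineP. Qed.

Lemma part1P x : reflect (exists c, x = c *: e1) (x \in part g true).
Proof. by case: basis => _ _ ->; apply: vlineP. Qed.

Lemma e0_even : e0 \in part g false.
Proof. by apply/part0P; exists 1; rewrite scale1r. Qed.

Lemma e1_odd : e1 \in part g true.
Proof. by apply/part1P; exists 1; rewrite scale1r. Qed.

Lemma coord11 x : exists u v, x = u *: e0 + v *: e1.
Proof.
have : x \in (part g false + part g true)%VS by rewrite part_sum memvf.
case/memv_addP=> _ /part0P[u ->] [_ /part1P[v ->] ->]; by exists u, v.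
Qed.

Lemma eq_lfun11 D D' : D e0 = D' e0 -> D e1 = D' e1 -> D = D'.
Proof.
move=> h0 h1; apply/lfunP=> x; have [u [v ->]] := coord11 x.
by rewrite !linearD !linearZ /= h0 h1.
Qed.

Lemma br_e0e0 : br g e0 e0 = 0.
Proof. exact: br_even_diag e0_even. Qed.

Lemma br_e1e0 : br g e1 e0 = - br g e0 e1.
Proof. by rewrite (br_skew e1_odd e0_even) scale1r. Qed.

Lemma e0_central_not_complete : br g e0 e1 = 0 -> ~ complete_hls g.
Proof.
move=> h01; apply: (central_not_complete (x := e0)) e0_neq0 _ => y.
have [u [v ->]] := coord11 y.
by rewrite linearD !linearZ /= br_e0e0 h01 !scaler0 addr0.
Qed.

(** Were alpha e1 = b e1 with b nonzero, this would fail: [e0, b e1] would have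
    to vanish. With alpha e1 = 0, every term of the Leibniz rule in which the odd
    part could intervene is zero. *)
Lemma even_proj_der a :
    br g e0 e1 = e1 -> br g e1 e1 = 0 -> twist g e0 = a *: e0 ->
    twist g e1 = 0 ->
  der 1 (even_proj g).
Proof.
move=> h01 h11 t0 t1.
exists (even_proj g), 0; split; last by rewrite addr0.
  split=> [[] x xP | x | i j x y].
  - by rewrite even_projE1 // mem0v.
  - by rewrite even_projE0.
  - have [u [v ->]] := coord11 x.
    rewrite !linearD !linearZ /= t0 t1 (even_projE1 e1_odd).
    by rewrite !linearZ /= (even_projE0 e0_even) t0 !linear0 !scalerA mulrC.
  - rewrite scale1r !twist_powS !twist_pow0.
    case: i j => [] [].
    + move=> uP vP; rewrite (even_projE1 uP) (even_projE1 vP).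
      move: uP vP => /part1P[u ->] /part1P[v ->].
      by rewrite br_scale h11 !linear0 zero_lfunE addr0.
    + move=> uP vP; rewrite (even_projE1 uP) (even_projE0 vP).
      move: uP vP => /part1P[u ->] /part0P[v ->].
      rewrite even_projE1; last first.
        by rewrite br_scale br_e1e0 h01 rpredZ ?rpredN ?e1_odd.
      by rewrite [twist g (u *: e1)]linearZ /= t1 !linear0 !zero_lfunE addr0.
    + move=> uP vP; rewrite (even_projE0 uP) (even_projE1 vP).
      move: uP vP => /part0P[u ->] /part1P[v ->].
      rewrite even_projE1; last by rewrite br_scale h01 rpredZ ?e1_odd.
      by rewrite [twist g (v *: e1)]linearZ /= t1 !linear0 addr0.
    + move=> uP vP; rewrite (even_projE0 uP) (even_projE0 vP).
      move: uP vP => /part0P[u ->] /part0P[v ->].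
      rewrite [twist g (u *: e0)]linearZ [twist g (v *: e0)]linearZ /= t0.
      rewrite !scalerA !br_scale br_e0e0.
      by rewrite !scaler0 linear0 addr0.
split=> [i x _ | x | i j x y _ _]; rewrite !zero_lfunE ?mem0v ?linear0 //.
by rewrite ?zero_lfunE ?linear0 ?scaler0 ?addr0.
Qed.

(** The fixed odd elements vanish since alpha kills e1, so evaluating at e0 a
    putative expression of the even projection as an inner derivation gives
    e0 = u [e0, e0] = 0. *)
Lemma twist_e1_not_complete a :
    br g e0 e1 = e1 -> br g e1 e1 = 0 -> twist g e0 = a *: e0 ->
    twist g e1 = 0 ->
  ~ complete_hls g.
Proof.
move=> h01 h11 t0 t1 [_ /(_ 0%N (even_proj g))[inn _]].
have /inner_derP[y0 [y1 [/part0P[u ->] /part1P[v ->] _]]] :=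
  inn (even_proj_der h01 h11 t0 t1).
rewrite linearZ /= t1 scaler0 => <- /(congr1 (fun D : 'End(g) => D e0)).
rewrite linear0 addr0 even_projE0 ?e0_even // adE twist_pow0 br_scalel.
by rewrite br_e0e0 scaler0 => /eqP; rewrite (negPf e0_neq0).
Qed.

(** Evaluating a derivation D on e1 = [e0, e1] leaves only two parameters, q and
    r, with D e0 = r e1 and D e1 = q e1; the fixed elements (q / b^k) e0 and
    - r e1 realize them. When b differs from 1 the second element is simply 0, so
    no case distinction on b is needed. *)
Lemma g3_complete b : b != 0 ->
    br g e0 e1 = e1 -> br g e1 e1 = 0 -> twist g e0 = e0 ->
    twist g e1 = b *: e1 ->
  complete_hls g.
Proof.
move=> b0 h01 h11 t0 t1.
have p0 k : twist_pow g k e0 = e0.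
  by rewrite (@twist_pow_eigen _ _ _ 1) ?expr1n ?scale1r.
have p1 k := twist_pow_eigen k t1.
split=> [x | k D].
  split=> [cx | -> y]; last by rewrite linear0 zero_lfunE.
  have [u [v xE]] := coord11 x.
  have := cx e0; have := cx e1.
  rewrite xE linearD !linearZ /= !add_lfunE !scale_lfunE.
  rewrite br_e0e0 br_e1e0 h01 h11.
  rewrite !scaler0 addr0 add0r scalerN => /eqP.
  rewrite scaler_eq0 (negPf e1_neq0) orbF => /eqP-> /eqP.
  rewrite oppr_eq0 scaler_eq0 (negPf e1_neq0) orbF => /eqP->.
  by rewrite !scale0r addr0.
split; last exact: inner_der_der.
case=> D0 [D1 [[ev0 _ der0] [ev1 com1 der1] ->]]; apply/inner_derP.
have /part0P[p D0e0] := ev0 false e0 e0_even.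
have /part1P[q D0e1] := ev0 true e1 e1_odd.
have /part1P[r D1e0] := ev1 false e0 e0_even.
have /part0P[s D1e1] := ev1 true e1 e1_odd.
have p_eq0 : p = 0.
  have := der0 false true e0 e1 e0_even e1_odd.
  rewrite h01 D0e0 D0e1 p0 p1 scale1r br_scale.
  rewrite [br g e0 (q *: e1)]linearZ /= h01.
  rewrite -[LHS]add0r => /addIr/esym/eqP.
  rewrite scaler_eq0 mulf_eq0 expf_eq0 (negPf b0) (negPf e1_neq0) !orbF.
  by move/eqP.
have s_eq0 : s = 0.
  have := der1 false true e0 e1 e0_even e1_odd.
  rewrite h01 D1e0 D1e1 p0 p1 scale1r br_scale h11.
  rewrite [br g e0 (s *: e0)]linearZ /= br_e0e0.
  rewrite !scaler0 addr0 => /eqP.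
  by rewrite scaler_eq0 (negPf e0_neq0) orbF => /eqP.
(* D1 commutes with alpha and e0 is fixed, hence so is D1 e0. *)
have fix1 : twist g (r *: e1) = r *: e1 by rewrite -D1e0 -com1 t0.
(* ad^k e0 scales e1 by b^k, and ad^k e1 sends e0 to - e1; whence the two
   coefficients. *)
exists ((q / b ^+ k) *: e0), ((- r) *: e1); split.
- by rewrite rpredZ // e0_even.
- by rewrite rpredZ // e1_odd.
- by rewrite linearZ /= t0.
- by rewrite scaleNr linearN /= fix1.
apply: eq_lfun11; rewrite !add_lfunE !adE ?p0 ?p1.
  rewrite !br_scalel br_e0e0 br_e1e0 h01 D0e0 p_eq0 D1e0.
  by rewrite scale0r scaler0 scaleNr scalerN opprK.
rewrite !br_scale h01 h11 D0e1 D1e1 s_eq0 scale0r scaler0.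
by rewrite divfK // expf_eq0 (negPf b0) andbF.
Qed.

End Superdimension11.

Theorem theorem4p1 (R : realType) (g : homLieSuperalgebra (complex R))
    (g_listed :
      is_g1_02 g
      \/ is_g2_11 g
      \/ (exists b : complex R, is_g3_11 g b)
      \/ (exists a : complex R, [/\ a != 0, a != 1 & is_g4_11 g a])
      \/ (exists b : complex R, b != 0 /\ is_g5_11 g b)) :
  complete_hls g <-> exists b : complex R, b != 0 /\ is_g3_11 g b.
Proof.
have two : (2 : complex R) != 0 by rewrite pnatr_eq0.
split=> [comp | [b [b0 [e0 [e1 [basis [h01 h11 t0 t1]]]]]]]; last first.
  exact: g3_complete h01 h11 t0 t1.
case: g_listed =>
  [[sd ab] | [[sd ab] | [[b g3] | [[a [_ _ g4]] | [b [_ g5]]]]]].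
- by case: (abelian_not_complete (m := 0) (n := 2) _ sd ab comp).
- by case: (abelian_not_complete (m := 1) (n := 1) _ sd ab comp).
- exists b; split=> //; apply/eqP=> b0.
  case: g3 => e0 [e1 [basis [h01 h11 t0 t1]]].
  apply: (twist_e1_not_complete two basis (a := 1)) comp; rewrite ?scale1r //.
  by rewrite t1 b0 scale0r.
- case: g4 => e0 [e1 [basis [h01 h11 t0 t1]]].
  by case: (twist_e1_not_complete two basis h01 h11 t0 t1 comp).
- case: g5 => e0 [e1 [basis [h01 h11 t0 t1]]].
  by case: (e0_central_not_complete two basis h01 comp).
Qed.
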